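(* Let $M \ge 2$ and $N > 2$ be integers, let $r \in \{1,\dots,M\}$, and for $\vec{k}\in\mathcal{D}_M$ with $K=\sum_{l=1}^M k_l$ let $\left(U_{\vec{k}},V_{\vec{k}}\right)=\mathcal{F}_K\left(X^{N,r}_{\vec{k}},Y^{N,r}_{\vec{k}}\right)$. Then the following statements are equivalent: (i) $N$ is prime; (ii) for all $\vec{k} \in \mathcal{D}_M$: $\mathbf{1}_{\mathbb{Z}\setminus N\mathbb{Z}}(U_{\vec{k}})=\frac{1+(-1)^K}{2}$; (iii) for all $\vec{k} \in \mathcal{D}_M$: $\mathbf{1}_{\mathbb{Z}\setminus N\mathbb{Z}}(V_{\vec{k}})=\frac{1-(-1)^K}{2}$; (iv) for all $\vec{k} \in \mathcal{D}_M$: $\left|\mathbf{1}_{\mathbb{Z}\setminus N\mathbb{Z}}(U_{\vec{k}})-\mathbf{1}_{\mathbb{Z}\setminus N\mathbb{Z}}(V_{\vec{k}})\right|=1$.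
   Context: $\mathcal{D}_M$ (depending on $N$) is the set of integer vectors $\vec{k}=(k_1,\dots,k_M)$ with all $k_l\ge 0$ and $K:=\sum_{l=1}^M k_l$ satisfying $0\le K\le N-1$. The multinomial coefficient is $\binom{K}{\vec{k}}=\binom{K}{k_1,\dots,k_M}=\frac{K!}{\prod_{l=1}^M k_l!}$. For $\vec{k}\in\mathcal{D}_M$ and $r\in\{1,\dots,M\}$, define the multinomial coefficient $T^{N,r}_{\vec{k}}=\binom{N-1-k_r}{k_1,\dots,k_{r-1},\,N-1-K,\,k_{r+1},\dots,k_M}$ (the $r$-th lower entry $k_r$ is replaced by $N-1-K$), and $X^{N,r}_{\vec{k}}=\binom{K}{\vec{k}}-(-1)^{K+k_r}\,T^{N,r}_{\vec{k}}$, $Y^{N,r}_{\vec{k}}=\binom{K}{\vec{k}}+(-1)^{K+k_r}\,T^{N,r}_{\vec{k}}$. For an integer $z$, $\mathcal{F}_z$ is the linear map $\mathcal{F}_z(X,Y)=\left(\frac{1-(-1)^z}{2}X+\frac{1+(-1)^z}{2}Y,\ \frac{1+(-1)^z}{2}X+\frac{1-(-1)^z}{2}Y\right)$. Thus, with $z=K$, $U_{\vec{k}}=\binom{K}{\vec{k}}+(-1)^{k_r}T^{N,r}_{\vec{k}}$ and $V_{\vec{k}}=\binom{K}{\vec{k}}-(-1)^{k_r}T^{N,r}_{\vec{k}}$. For an integer $x$, $\mathbf{1}_{\mathbb{Z}\setminus N\mathbb{Z}}(x)$ equals $0$ if $N$ divides $x$, and $1$ otherwise. *)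

(* Defs.v *)
From mathcomp Require Import all_boot all_order all_algebra.

Set Implicit Arguments.
Unset Strict Implicit.
Unset Printing Implicit Defensive.

Import Order.TTheory GRing.Theory Num.Theory.

Local Open Scope ring_scope.

Definition vsum (M : nat) (k : {ffun 'I_M -> nat}) : nat :=
  (\sum_(l < M) k l)%N.

(* Only used with n = vsum k, in which case the division is exact. *)
Definition multinomial (M : nat) (n : nat) (k : {ffun 'I_M -> nat}) : nat :=
  (n`! %/ \prod_(l < M) (k l)`!)%N.

Definition inD (N M : nat) (k : {ffun 'I_M -> nat}) : bool :=
  (vsum k <= N - 1)%N.

(* The truncated subtractions are genuine ones when inD N k holds and 0 < N;
   the lower entries then add up to N - 1 - k r. *)
Definition Tcoef (N M : nat) (r : 'I_M) (k : {ffun 'I_M -> nat}) : nat :=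
  multinomial (N - 1 - k r)
    [ffun l => if l == r then (N - 1 - vsum k)%N else k l].

Definition Xcoef (N M : nat) (r : 'I_M) (k : {ffun 'I_M -> nat}) : int :=
  (multinomial (vsum k) k)%:Z - (-1) ^+ (vsum k + k r) * (Tcoef N r k)%:Z.

Definition Ycoef (N M : nat) (r : 'I_M) (k : {ffun 'I_M -> nat}) : int :=
  (multinomial (vsum k) k)%:Z + (-1) ^+ (vsum k + k r) * (Tcoef N r k)%:Z.

(* (1 + (-1)^z) / 2 and (1 - (-1)^z) / 2; both divisions are exact. As -1 is a
   unit of int, (-1) ^ z has its usual meaning for negative z too. *)
Definition even_weight (z : int) : int := ((1 + (-1) ^ z) %/ 2)%Z.
Definition odd_weight (z : int) : int := ((1 - (-1) ^ z) %/ 2)%Z.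

Definition Fmap (z : int) (XY : int * int) : int * int :=
  (odd_weight z * XY.1 + even_weight z * XY.2,
   even_weight z * XY.1 + odd_weight z * XY.2).

Definition Ucoef (N M : nat) (r : 'I_M) (k : {ffun 'I_M -> nat}) : int :=
  (Fmap (vsum k)%:Z (Xcoef N r k, Ycoef N r k)).1.

Definition Vcoef (N M : nat) (r : 'I_M) (k : {ffun 'I_M -> nat}) : int :=
  (Fmap (vsum k)%:Z (Xcoef N r k, Ycoef N r k)).2.

(* The indicator function of the complement of N Z in Z. *)
Definition ind_nmul (N : nat) (x : int) : int :=
  if (N%:Z %| x)%Z then 0 else 1.

(* Main.v *)
Require Import Defs.
From mathcomp Require Import all_boot all_order all_algebra.
From mathcomp Require Import zify ring.
Set Implicit Arguments.
Unset Strict Implicit.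
Unset Printing Implicit Defensive.

Import Order.TTheory GRing.Theory Num.Theory.
Local Open Scope ring_scope.

(** Write m for the multinomial coefficient of k and T for its companion. The
parity switch F_K cancels the sign (-1)^K, so that for every k
  U = m + (-1)^(k r) T   and   V = m - (-1)^(k r) T.

If N = p is an odd prime, Wilson's theorem in the form
(p-1-a)! a! = (-1)^(a+1) mod p evaluates the two factorials (p-1-k_r)! and
(p-1-K)! occurring in T and gives T = (-1)^(K + k_r) m mod p [Tcoef_Fp]. Hence
U = (1 + (-1)^K) m and V = (1 - (-1)^K) m mod p. As K < p, the prime p does not
divide K!, let alone m, and p does not divide 2 either: exactly one of U and V
is a multiple of p, the parity of K telling which one.

Conversely, suppose that N is composite and let p be its least prime factor.
Taking k with a single nonzero entry a, at a place other than r, gives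
U = C(N-1, a) + 1 and V = 1 - C(N-1, a), so each of the congruence conditions
turns into C(N-1, a) = (-1)^a mod N, for the odd or for the even a. That
congruence holds for a < p, and fails both for a = p and for a = p + 1
[bin_defect_pdiv]: by Pascal's rule its failure comes from C(N, p), which is
N/p times a number prime to p, hence is not a multiple of N. One of p and p + 1
is odd and the other even, which refutes the conditions on U alone and on V
alone. For the condition that compares U and V, take a = p: one of U and V is,
up to sign, the nonzero defect C(N-1, p) - (-1)^p, so the other one, which
differs from it by 2 up to sign, has to vanish mod N. This forces N to divide
2p, that is N = 4; there k = e_r + e_l has U = 0 and V = 4, both multiples
of 4. *)

(** * Exactness of the coefficients, and U and V without the parity switch *)

Lemma dvdn_prod_fact_sum (I : Type) (s : seq I) (k : I -> nat) :
  (\prod_(i <- s) (k i)`! %| (\sum_(i <- s) k i)`!)%N.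
Proof.
elim: s => [|i s IHs]; first by rewrite !big_nil.
rewrite !big_cons -(bin_fact (leq_addr _ (k i))) addKn.
by rewrite dvdn_mull // dvdn_mul.
Qed.

Lemma multinomial_fact (M : nat) (k : {ffun 'I_M -> nat}) :
  (multinomial (vsum k) k * \prod_(l < M) (k l)`! = (vsum k)`!)%N.
Proof. by rewrite divnK // dvdn_prod_fact_sum. Qed.

Lemma even_weightE (K : nat) : even_weight K%:Z = (~~ odd K)%:R.
Proof. by rewrite /even_weight -exprnP -signr_odd; case: (odd K). Qed.

Lemma odd_weightE (K : nat) : odd_weight K%:Z = (odd K)%:R.
Proof. by rewrite /odd_weight -exprnP -signr_odd; case: (odd K). Qed.

Lemma UcoefE (N M : nat) (r : 'I_M) (k : {ffun 'I_M -> nat}) :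
  Ucoef N r k = (multinomial (vsum k) k)%:Z + (-1) ^+ k r * (Tcoef N r k)%:Z.
Proof.
rewrite /Ucoef /= even_weightE odd_weightE /Xcoef /Ycoef exprD.
by rewrite -(signr_odd _ (vsum k)); case: (odd _) => /=; ring.
Qed.

Lemma VcoefE (N M : nat) (r : 'I_M) (k : {ffun 'I_M -> nat}) :
  Vcoef N r k = (multinomial (vsum k) k)%:Z - (-1) ^+ k r * (Tcoef N r k)%:Z.
Proof.
rewrite /Vcoef /= even_weightE odd_weightE /Xcoef /Ycoef exprD.
by rewrite -(signr_odd _ (vsum k)); case: (odd _) => /=; ring.
Qed.

Lemma ind_nmulE (N : nat) (x : int) : ind_nmul N x = (~~ (N%:Z %| x)%Z)%:R.
Proof. by rewrite /ind_nmul; case: (_ %| _)%Z. Qed.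

(** * The coefficients modulo a prime *)

Lemma fact_neq0_Fp (p a : nat) : prime p -> (a < p)%N -> (a`!)%:R != 0 :> 'F_p.
Proof.
move=> p_pr lt_ap; rewrite -(dvdn_pcharf (pchar_Fp p_pr)).
elim: a lt_ap => [|a IHa] lt_ap; first by rewrite Euclid_dvd1.
by rewrite factS Euclid_dvdM // negb_or IHa ?(ltnW lt_ap) // andbT gtnNdvd.
Qed.

(** Wilson's theorem is the case a = 0. Passing from a to a + 1 moves the factor
p - 1 - a = - (a + 1) from one factorial to the other, which flips the sign. *)
Lemma fact_compl_Fp (p a : nat) : prime p -> (a < p)%N ->
  ((p - 1 - a)`!)%:R * (a`!)%:R = (-1) ^+ a.+1 :> 'F_p.
Proof.
move=> p_pr; elim: a => [|a IHa] lt_ap.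
  rewrite subn0 subn1 fact0 mulr1 expr1; apply/eqP.
  rewrite -subr_eq0 opprK natr1 -(dvdn_pcharf (pchar_Fp p_pr)).
  by rewrite -Wilson ?prime_gt1.
have b_neq0: (p - 1 - a)%:R != 0 :> 'F_p.
  rewrite -(dvdn_pcharf (pchar_Fp p_pr)) gtnNdvd //; lia.
apply: (mulfI b_neq0); rewrite exprS mulN1r mulrN -IHa ?(ltnW lt_ap) //.
have -> : (p - 1 - a = (p - 1 - a.+1).+1)%N by lia.
set b := (p - 1 - a.+1)%N.
have /eqP: (b.+1 + a.+1)%:R = 0 :> 'F_p.
  by rewrite -(pchar_Fp_0 p_pr); congr (_%:R); rewrite /b; lia.
rewrite natrD addr_eq0 => /eqP eq_b.
by rewrite !factS !natrM eq_b; ring.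
Qed.

Section Prime.
Variables (M p : nat) (r : 'I_M) (k : {ffun 'I_M -> nat}).
Hypotheses (p_pr : prime p) (kD : inD p k).

Let lt_Kp : (vsum k < p)%N.
Proof. by move: kD (prime_gt0 p_pr); rewrite /inD; lia. Qed.

Let le_kr : (k r <= vsum k)%N.
Proof. by rewrite /vsum (bigD1 r) //= leq_addr. Qed.

Lemma multinomial_neq0_Fp : (multinomial (vsum k) k)%:R != 0 :> 'F_p.
Proof.
have := fact_neq0_Fp p_pr lt_Kp.
by rewrite -multinomial_fact natrM mulf_eq0 negb_or => /andP[].
Qed.

(** Both T and m are quotients of factorials over the common product Q of the
k_l! with l <> r, namely T = (p-1-k_r)! / ((p-1-K)! Q) and m = K! / (k_r! Q);
the complement formula for factorials exchanges the two up to sign. *)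
Lemma Tcoef_Fp :
  (Tcoef p r k)%:R
    = (-1) ^+ (vsum k + k r) * (multinomial (vsum k) k)%:R :> 'F_p.
Proof.
pose Q := (\prod_(l < M | l != r) (k l)`!)%N.
have m_eq : (multinomial (vsum k) k * ((k r)`! * Q) = (vsum k)`!)%N.
  by rewrite -(multinomial_fact k) (bigD1 r).
have T_eq : (Tcoef p r k * ((p - 1 - vsum k)`! * Q) = (p - 1 - k r)`!)%N.
  rewrite /Tcoef; set k' := finfun _.
  have -> : (p - 1 - k r = vsum k')%N.
    rewrite /vsum (bigD1 r) //= ffunE eqxx.
    under eq_bigr => l /negPf lr do rewrite ffunE lr.
    move: kD; rewrite /inD /vsum (bigD1 r) //=; lia.
  rewrite -(multinomial_fact k') (bigD1 r) //= ffunE eqxx.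
  by congr (_ * (_ * _))%N; apply: eq_bigr => l /negPf lr; rewrite ffunE lr.
have W1 := fact_compl_Fp p_pr lt_Kp.
have W2 := fact_compl_Fp p_pr (leq_ltn_trans le_kr lt_Kp).
have := fact_neq0_Fp p_pr lt_Kp.
rewrite -m_eq !natrM !mulf_eq0 !negb_or => /and3P[_ kr0 Q0].
move/(congr1 (fun n => n%:R : 'F_p)): m_eq; rewrite !natrM => m_eq.
move/(congr1 (fun n => n%:R : 'F_p)): T_eq; rewrite !natrM => T_eq.
apply: (mulIf Q0); apply: (mulIf kr0).
(* Solving the complement formulas for the signs lets them be replaced by
   factorials, after which only a polynomial identity is left. *)
have [W1' W2'] : (-1) ^+ vsum k = - ((p - 1 - vsum k)`!%:R * (vsum k)`!%:R) :> 'F_p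
    /\ (-1) ^+ k r = - ((p - 1 - k r)`!%:R * (k r)`!%:R) :> 'F_p.
  by rewrite W1 W2 !exprS !mulN1r !opprK.
have sgnK : (-1) ^+ vsum k * (-1) ^+ vsum k = 1 :> 'F_p.
  by rewrite -expr2 sqrr_sign.
rewrite exprD W2' -T_eq -[LHS]mul1r -{1}sgnK {2}W1' -m_eq.
by ring.
Qed.
End Prime.

(** * Binomial coefficients and the least prime factor *)

Lemma coprime_lt_pdiv (N m : nat) :
  (0 < N)%N -> (0 < m < pdiv N)%N -> coprime N m.
Proof.
move=> N_gt0 /andP[m_gt0 lt_mp]; rewrite /coprime eqn_leq gcdn_gt0 N_gt0 andbT.
rewrite leqNgt; apply/negP=> /pdiv_min_dvd/(_ (dvdn_gcdl N m)) le_pg.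
by have := dvdn_leq m_gt0 (dvdn_gcdr N m); lia.
Qed.

Lemma dvdn_bin_lt_pdiv (N a : nat) :
  (0 < N)%N -> (0 < a < pdiv N)%N -> (N %| 'C(N, a))%N.
Proof.
case: N => // N _; case: a => // a /(coprime_lt_pdiv (ltn0Sn N)) co_Na.
by rewrite -(Gauss_dvdr _ co_Na) -mul_bin_diag dvdn_mulr.
Qed.

(** The least prime factor p of N is the first a at which this is nonzero
modulo N. *)
Definition bin_defect (N a : nat) : int := 'C(N.-1, a)%:Z - (-1) ^+ a.

(** Pascal's rule: the alternating signs cancel, so consecutive defects add up to
a binomial coefficient of N itself. *)
Lemma bin_defectS (N a : nat) : (0 < N)%N ->
  bin_defect N a.+1 = 'C(N, a.+1)%:Z - bin_defect N a.
Proof.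
by case: N => // N _; rewrite /bin_defect binS PoszD exprS /=; ring.
Qed.

(** For 0 < a < p the coefficient C(N, a) is a multiple of N, so the vanishing of
the defect at 0 propagates up to p - 1. *)
Lemma dvdz_bin_defect (N a : nat) :
  (0 < N)%N -> (a < pdiv N)%N -> (N%:Z %| bin_defect N a)%Z.
Proof.
move=> N_gt0; elim: a => [|a IHa] lt_ap; first by rewrite /bin_defect bin0.
rewrite bin_defectS //; apply: rpredB; first exact: dvdn_bin_lt_pdiv.
exact/IHa/ltnW.
Qed.

(** C(N, p) = (N/p) C(N-1, p-1), and C(N-1, p-1) is prime to p because it is
congruent to a sign modulo N. *)
Lemma dvdz_mul_bin_pdiv (N : nat) (x : int) : (1 < N)%N ->
  (N%:Z %| x * 'C(N, pdiv N)%:Z)%Z = ((pdiv N)%:Z %| x)%Z.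
Proof.
move=> N_gt1; have N_gt0 := ltnW N_gt1.
have p_pr := pdiv_prime N_gt1; set p := pdiv N in p_pr *.
have p_gt0 := prime_gt0 p_pr.
have co_p : coprimez p%:Z 'C(N.-1, p.-1)%:Z.
  rewrite coprimezE /= prime_coprime //; apply/negP=> p_dvd.
  have: (p%:Z %| bin_defect N p.-1)%Z.
    apply: dvdz_trans (dvdz_bin_defect N_gt0 _); first exact: pdiv_dvd.
    by rewrite prednK.
  rewrite rpredBl // dvdzE abszX exp1n /=.
  by rewrite Euclid_dvd1.
have binE : 'C(N, p) = (N %/ p * 'C(N.-1, p.-1))%N.
  apply/eqP; rewrite -(eqn_pmul2l p_gt0) mulnA (mulnC p (_ %/ _)%N).
  by rewrite divnK ?pdiv_dvd // mul_bin_diag prednK.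
have Np_neq0 : (N %/ p)%:Z != 0.
  by rewrite -lt0n divn_gt0 // pdiv_leq.
have NE : N%:Z = (N %/ p)%:Z * p%:Z by rewrite -PoszM divnK ?pdiv_dvd.
rewrite binE PoszM mulrCA -(Gauss_dvdzl x co_p).
by rewrite -[RHS](dvdz_mul2l Np_neq0) -NE.
Qed.

Lemma dvdz_bin_sub_defect_pdiv (N : nat) : (1 < N)%N ->
  (N%:Z %| 'C(N, pdiv N)%:Z - bin_defect N (pdiv N))%Z.
Proof.
move=> N_gt1; have N_gt0 := ltnW N_gt1; have p_gt0 := pdiv_gt0 N.
have := bin_defectS (pdiv N).-1 N_gt0; rewrite prednK // => ->.
by rewrite opprB addrC subrK dvdz_bin_defect ?prednK.
Qed.

(** At p the defect is C(N, p) modulo N. At p + 1 it is C(N, p+1) - C(N, p), and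
since (p + 1) C(N, p+1) = (N - p) C(N, p), multiplying by p + 1 leaves
- (2p + 1) C(N, p) modulo N, where 2p + 1 is prime to p. *)
Lemma bin_defect_pdiv (N : nat) : (1 < N)%N ->
  ~~ (N%:Z %| bin_defect N (pdiv N))%Z
    /\ ~~ (N%:Z %| bin_defect N (pdiv N).+1)%Z.
Proof.
move=> N_gt1; have N_gt0 := ltnW N_gt1.
have p_gt1 := prime_gt1 (pdiv_prime N_gt1).
have p_ndvd1 : ~~ ((pdiv N)%:Z %| 1)%Z by rewrite dvdzE dvdn1; lia.
have Ny := dvdz_bin_sub_defect_pdiv N_gt1.
set y := _ - _ in Ny.
have defE : bin_defect N (pdiv N) = 'C(N, pdiv N)%:Z - y by rewrite /y; ring.
split.
  by rewrite defE rpredBr // -[X in (_ %| X)%Z]mul1r dvdz_mul_bin_pdiv.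
apply: contra p_ndvd1 => /(dvdz_mull (pdiv N).+1%:Z).
have -> : (pdiv N).+1%:Z * bin_defect N (pdiv N).+1 =
    N%:Z * 'C(N, pdiv N)%:Z + (pdiv N).+1%:Z * y
     - (2 * (pdiv N)%:Z + 1) * 'C(N, pdiv N)%:Z.
  have := mul_bin_left N (pdiv N) => /(congr1 Posz).
  rewrite !PoszM -subzn ?pdiv_leq // => binE.
  by rewrite bin_defectS // defE mulrBr binE intS; ring.
have Ny' : (N%:Z %| N%:Z * 'C(N, pdiv N)%:Z + (pdiv N).+1%:Z * y)%Z.
  by apply: rpredD; [exact: dvdz_mulr (dvdzz _) | exact: dvdz_mull].
rewrite rpredBl //.
by rewrite dvdz_mul_bin_pdiv // rpredDl // dvdz_mull.
Qed.

(** * Vectors with two nonzero entries *)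

Definition two_entries (M : nat) (r l : 'I_M) (b a : nat) : {ffun 'I_M -> nat} :=
  [ffun i => if i == r then b else if i == l then a else 0%N].

Section TwoEntries.
Variables (M : nat) (r l : 'I_M).
Hypothesis lr : l != r.

Lemma big_two_entries (R : Type) (idx : R) (op : Monoid.com_law idx) (F : nat -> R)
    (b a : nat) : F 0%N = idx ->
  \big[op/idx]_(i < M) F (two_entries r l b a i) = op (F b) (F a).
Proof.
move=> F0; rewrite (bigD1 r) //= (bigD1 l) //= !ffunE !eqxx (negPf lr).
rewrite big1 ?Monoid.mulm1 // => i /andP[/negPf ir /negPf il].
by rewrite ffunE ir il.
Qed.

Lemma vsum_two_entries (b a : nat) : vsum (two_entries r l b a) = (b + a)%N.
Proof. exact: (@big_two_entries _ _ addn id). Qed.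

Lemma multinomial_two_entries (b a : nat) :
  multinomial (b + a) (two_entries r l b a) = 'C(b + a, a).
Proof.
rewrite /multinomial (@big_two_entries _ _ muln factorial) //.
rewrite -(bin_fact (leq_addl b a)) addnK /= (mulnC b`!).
by rewrite mulnK // muln_gt0 !fact_gt0.
Qed.

Lemma Tcoef_two_entries (N b a : nat) : (b + a <= N - 1)%N ->
  Tcoef N r (two_entries r l b a) = 'C(N - 1 - b, a).
Proof.
move=> le_baN; rewrite /Tcoef vsum_two_entries {1}ffunE eqxx.
have -> : (N - 1 - b = N - 1 - (b + a) + a)%N by lia.
rewrite -multinomial_two_entries; congr multinomial.
by apply/ffunP=> i; rewrite !ffunE; case: (i == r).
Qed.
End TwoEntries.

(** * Both directions of the equivalence *)

Lemma dvdz_UV_prime (M N : nat) (r : 'I_M) (k : {ffun 'I_M -> nat}) :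
    prime N -> (2 < N)%N -> inD N k ->
  (N%:Z %| Ucoef N r k)%Z = odd (vsum k)
    /\ (N%:Z %| Vcoef N r k)%Z = ~~ odd (vsum k).
Proof.
move=> N_pr N_gt2 kD; have chN := pchar_Fp N_pr.
have m_neq0 := multinomial_neq0_Fp N_pr kD.
have two_neq0 : 2%:R != 0 :> 'F_N by rewrite -(dvdn_pcharf chN) gtnNdvd.
have T_sgn : (-1) ^+ k r * (Tcoef N r k)%:R
    = (-1) ^+ odd (vsum k) * (multinomial (vsum k) k)%:R :> 'F_N.
  rewrite (Tcoef_Fp r N_pr kD) signr_odd mulrA; congr (_ * _).
  by rewrite exprD mulrCA -expr2 sqrr_sign mulr1.
rewrite !(dvdz_pcharf chN) UcoefE VcoefE.
rewrite rmorphB rmorphD /= rmorphM /= rmorphXn /= rmorphN1 -!pmulrn T_sgn.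
case: (odd _); rewrite ?expr0 ?expr1 ?mulN1r ?mul1r ?opprK ?subrr ?eqxx.
  by rewrite -mulr2n -mulr_natl mulf_eq0 (negPf two_neq0) (negPf m_neq0).
by rewrite -mulr2n -mulr_natl mulf_eq0 (negPf two_neq0) (negPf m_neq0).
Qed.

Lemma UV_single_entry (M N : nat) (r l : 'I_M) (a : nat) :
    l != r -> (a <= N - 1)%N ->
  [/\ inD N (two_entries r l 0 a), vsum (two_entries r l 0 a) = a,
      Ucoef N r (two_entries r l 0 a) = 'C(N.-1, a)%:Z + 1
    & Vcoef N r (two_entries r l 0 a) = 1 - 'C(N.-1, a)%:Z].
Proof.
move=> lr le_aN; have vE := vsum_two_entries lr 0 a.
have mE := multinomial_two_entries lr 0 a; rewrite add0n binn in mE.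
split; first by rewrite /inD vE.
- by rewrite vE.
- rewrite UcoefE vE mE Tcoef_two_entries // ffunE eqxx expr0 mul1r.
  by rewrite subn0 subn1 addrC.
by rewrite VcoefE vE mE Tcoef_two_entries // ffunE eqxx expr0 mul1r subn0 subn1.
Qed.

Lemma pdivS_lt_composite (N : nat) :
  (2 < N)%N -> ~~ prime N -> ((pdiv N).+1 <= N - 1)%N.
Proof.
move=> N_gt2; apply: contraR => lt_Np.
have p_gt1 := prime_gt1 (pdiv_prime (ltnW N_gt2)).
apply: ltn_pdiv2_prime; first lia.
rewrite expnS expn1; nia.
Qed.

(** The cofactor N/p divides 2 and is not 1; so N is even, and then p = 2. *)
Lemma composite_dvd_double_pdiv (N : nat) :
  (2 < N)%N -> ~~ prime N -> (N %| 2 * pdiv N)%N -> N = 4.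
Proof.
move=> N_gt2 N_npr N_dvd2p; have p_pr := pdiv_prime (ltnW N_gt2).
have lt_pN := pdivS_lt_composite N_gt2 N_npr.
have /dvdnP[q NE] := pdiv_dvd N.
have q2 : (q %| 2)%N by rewrite -(dvdn_pmul2r (pdiv_gt0 N)) -NE.
have q_le2 : (q <= 2)%N by apply: dvdn_leq.
have qE : q = 2 by case: q NE {q2} q_le2 => [|[|[|q]]] NE //; lia.
have p_le2 : (pdiv N <= 2)%N.
  by apply: pdiv_min_dvd => //; rewrite NE qE dvdn_mulr.
by have := prime_gt1 p_pr; rewrite qE in NE; lia.
Qed.

(** Among p and p + 1 one has the prescribed parity; both are at most N - 1
because p^2 <= N. *)
Lemma composite_bin_defect (N : nat) (b : bool) : (2 < N)%N -> ~~ prime N ->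
  exists a, [/\ (a <= N - 1)%N, odd a = b & ~~ (N%:Z %| bin_defect N a)%Z].
Proof.
move=> N_gt2 N_npr; have le_pN := pdivS_lt_composite N_gt2 N_npr.
have [dp dp1] := bin_defect_pdiv (ltnW N_gt2).
have [<-|odd_p] := eqVneq (odd (pdiv N)) b.
  by exists (pdiv N); split=> //; apply: ltnW.
by exists (pdiv N).+1; split=> //=; case: (odd _) b odd_p => [] [].
Qed.

Section Converse.
Variables (M N : nat) (r l : 'I_M).
Hypotheses (N_gt2 : (2 < N)%N) (lr : l != r).

Lemma prime_of_dvdz_U :
  (forall k : {ffun 'I_M -> nat}, inD N k -> odd (vsum k) ->
     (N%:Z %| Ucoef N r k)%Z) -> prime N.
Proof.
move=> HU; apply/negPn/negP => /(composite_bin_defect true N_gt2)[a [le_aN odd_a]].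
have [kD vE UE _] := UV_single_entry lr le_aN.
have := HU _ kD; rewrite vE UE => /(_ odd_a).
by rewrite /bin_defect -signr_odd odd_a expr1 opprK => ->.
Qed.

Lemma prime_of_dvdz_V :
  (forall k : {ffun 'I_M -> nat}, inD N k -> ~~ odd (vsum k) ->
     (N%:Z %| Vcoef N r k)%Z) -> prime N.
Proof.
move=> HV; apply/negPn/negP => /(composite_bin_defect false N_gt2)[a [le_aN odd_a]].
have [kD vE _ VE] := UV_single_entry lr le_aN.
have := HV _ kD; rewrite vE VE odd_a => /(_ isT).
by rewrite /bin_defect -signr_odd odd_a expr0 -opprB rpredN => ->.
Qed.

(** The vector with entry p detects every composite N but 4: for N = 4, each
vector with a single nonzero entry outside r meets the hypothesis, so that an
entry at r is needed as well. *)
Lemma prime_of_dvdz_UV :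
  (forall k : {ffun 'I_M -> nat}, inD N k ->
     (N%:Z %| Ucoef N r k)%Z != (N%:Z %| Vcoef N r k)%Z) -> prime N.
Proof.
move=> H; apply/negPn/negP => N_npr.
have N_gt1 := ltnW N_gt2; have p_pr := pdiv_prime N_gt1.
have le_pN := pdivS_lt_composite N_gt2 N_npr.
have [dp _] := bin_defect_pdiv N_gt1.
(* One of U and V is plus or minus the defect, which N does not divide; this
   expresses that N divides the other one. *)
have N_dvd : (N%:Z %| bin_defect N (pdiv N) + 2 * (-1) ^+ pdiv N)%Z.
  have [kD vE UE VE] := UV_single_entry lr (ltnW le_pN).
  have := H _ kD; rewrite UE VE; move: dp; rewrite /bin_defect -signr_odd.
  case: (odd _); rewrite ?expr0 ?expr1.
    rewrite opprK mulrN1 => /negPf->; case: (boolP (_ %| _)%Z) => // + _.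
    by rewrite -opprB rpredN; congr (_ %| _)%Z; ring.
  rewrite -opprB rpredN => /negPf->; case: (boolP (_ %| _)%Z) => // + _.
  by congr (_ %| _)%Z; ring.
(* Modulo N the defect at p is C(N, p), which the factor p annihilates. *)
have N_dvd2p : (N %| 2 * pdiv N)%N.
  have Ny := dvdz_bin_sub_defect_pdiv N_gt1.
  have NpC : (N%:Z %| (pdiv N)%:Z * 'C(N, pdiv N)%:Z)%Z.
    by rewrite dvdz_mul_bin_pdiv.
  have : (N%:Z %| 2 * (pdiv N)%:Z * (-1) ^+ pdiv N)%Z.
    have -> : 2 * (pdiv N)%:Z * (-1) ^+ pdiv N =
        (pdiv N)%:Z * (bin_defect N (pdiv N) + 2 * (-1) ^+ pdiv N)
        + (pdiv N)%:Z * ('C(N, pdiv N)%:Z - bin_defect N (pdiv N))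
        - (pdiv N)%:Z * 'C(N, pdiv N)%:Z by ring.
    by apply: rpredB => //; apply: rpredD; apply: dvdz_mull.
  by rewrite dvdzE !abszM abszX exp1n muln1.
have N4 := composite_dvd_double_pdiv N_gt2 N_npr N_dvd2p.
(* Here m = T = 2, whence U = 0 and V = 4. *)
have kD : inD N (two_entries r l 1 1) by rewrite /inD vsum_two_entries // N4.
have := H _ kD; rewrite UcoefE VcoefE vsum_two_entries //.
rewrite multinomial_two_entries // Tcoef_two_entries ?N4 // ffunE eqxx.
by [].
Qed.
End Converse.

Theorem theorem5p3 (M N : nat) (hM : (2 <= M)%N) (hN : (2 < N)%N) (r : 'I_M) :
  [<-> prime N;
       forall k : {ffun 'I_M -> nat}, inD N k ->
         ind_nmul N (Ucoef N r k) = even_weight (vsum k)%:Z;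
       forall k : {ffun 'I_M -> nat}, inD N k ->
         ind_nmul N (Vcoef N r k) = odd_weight (vsum k)%:Z;
       forall k : {ffun 'I_M -> nat}, inD N k ->
         `|ind_nmul N (Ucoef N r k) - ind_nmul N (Vcoef N r k)| = 1].
Proof.
have [l lr] : exists l : 'I_M, l != r.
  apply/existsP; rewrite -negb_forall; apply/forallP => r_all.
  have M_gt0 : (0 < M)%N by apply: ltnW.
  have /eqP := r_all (Ordinal M_gt0); have /eqP := r_all (Ordinal hM).
  by move=> <- /(congr1 val).
tfae.
- move=> N_pr k kD; rewrite ind_nmulE even_weightE.
  by have [-> _] := dvdz_UV_prime r N_pr hN kD.
- move=> HU; have N_pr : prime N.
    apply: (prime_of_dvdz_U hN lr) => k kD odd_k; apply/negPn.
    by have := HU k kD; rewrite ind_nmulE even_weightE odd_k; case: (_ %| _)%Z.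
  move=> k kD; rewrite ind_nmulE odd_weightE.
  by have [_ ->] := dvdz_UV_prime r N_pr hN kD; rewrite negbK.
- move=> HV; have N_pr : prime N.
    apply: (prime_of_dvdz_V hN lr) => k kD even_k; apply/negPn.
    have := HV k kD; rewrite ind_nmulE odd_weightE (negPf even_k).
    by case: (_ %| _)%Z.
  move=> k kD; have [UE VE] := dvdz_UV_prime r N_pr hN kD.
  by rewrite !ind_nmulE UE VE; case: (odd _).
move=> H; apply: (prime_of_dvdz_UV hN lr) => k kD.
by have := H k kD; rewrite !ind_nmulE; do 2 case: (_ %| _)%Z.
Qed.
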